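(* Let $n\ge 5$. Among all polyomino chains with $n$ squares, the chains maximizing the augmented Zagreb index $AZI$ are exactly: the chain $AZ^1_{(n-1)/2}$ when $n$ is odd, and the chains of the family $AZ^2_{n/2}$ when $n$ is even. Moreover, the maximum value is $$M(n)=\frac{4456}{125}n-\frac{26763}{2000}-\frac{2312}{3375}\,I_{\{n\text{ even}\}},$$ where $I_{\{n\text{ even}\}}$ equals $1$ if $n$ is even and $0$ otherwise.
   Context: Polyomino chains (restricted model). For $n\ge 2$, a polyomino chain with $n$ squares is a sequence of closed unit squares $S_1,\dots,S_n$ in the plane with $S_1=[0,1]\times[0,1]$, $S_2=[1,2]\times[0,1]$, and for $k\ge 3$, $S_k=S_{k-1}+v_k$, where $v_2=(1,0)$ and each $v_k\in\{(1,0),(0,-1)\}$ satisfies $v_k=v_{k-1}$ if $L_k=1$ and $v_k\neq v_{k-1}$ if $L_k=2$. For $n\ge3$ the chain is determined by its link vector $(L_3,\dots,L_n)\in\{1,2\}^{n-2}$ and denoted $PC(L_3,\dots,L_n)$. Each chain is regarded as the graph whose vertices are the corners of the squares and whose edges are the sides of the squares. The augmented Zagreb index is $AZI(G)=\sum_{uv\in E(G)}\left(\frac{d_ud_v}{d_u+d_v-2}\right)^3$, where $d_u$ is the degree of $u$. Segments: a segment of a chain is a maximal run of consecutive squares $S_a,S_{a+1},\dots,S_b$ ($b>a$) lying in a common row or a common column; consecutive segments share exactly one square (a kink, where the chain changes direction), so a chain with $m$ segments of lengths (numbers of squares) $l_1,\dots,l_m$ satisfies $\sum l_i=n+m-1$.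 A segment is external if it contains $S_1$ or $S_n$, and internal otherwise. $AZ^1_m$ ($m\ge2$) denotes the polyomino chain with $m$ segments all of length 3; $AZ^2_m$ ($m\ge3$) denotes the family of polyomino chains with $m$ segments all of length 3 except exactly one internal segment of length 2. *)

(* Defs.v *)
From mathcomp Require Export all_boot all_order all_algebra.

Set Implicit Arguments.
Unset Strict Implicit.
Unset Printing Implicit Defensive.

Import Order.TTheory GRing.Theory Num.Theory.

Local Open Scope ring_scope.

Definition point : Type := (int * int)%type.

(* The closed unit square [x, x+1] * [y, y+1] is represented by its lower-left
   corner (x, y), and a chain S_1, ..., S_n by the sequence of its squares;
   S_k is thus the item of index k - 1. *)
Definition chain : Type := seq point.

Definition right : point := (1, 0).
Definition down : point := (0, -1).

Definition other_dir (v : point) : point := if v == right then down else right.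

(* [s] is the current square S_{k-1}, [v] the last displacement v_{k-1}, and
   [L] the list of the remaining links L_k, ..., L_n. *)
Fixpoint squares_from (s v : point) (L : seq nat) : chain :=
  if L is l :: L' then
    let v' := if l == 1%N then v else other_dir v in
    s :: squares_from (s.1 + v'.1, s.2 + v'.2) v' L'
  else [:: s].

Definition link_vector (n : nat) (L : seq nat) : bool :=
  ((size L).+2 == n) && all [pred l | (l == 1%N) || (l == 2)] L.

Definition PC (L : seq nat) : chain := (0, 0) :: squares_from (1, 0) right L.

Definition polyomino_chain (n : nat) (c : chain) : Prop :=
  exists2 L : seq nat, link_vector n L & c = PC L.

(* An undirected side is stored once, with its lower or left endpoint first, so
   that a side shared by two squares has a single representation. *)
Definition sides (s : point) : seq (point * point) :=
  let: (x, y) := s in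
  [:: ((x, y), (x + 1, y)); ((x, y + 1), (x + 1, y + 1));
      ((x, y), (x, y + 1)); ((x + 1, y), (x + 1, y + 1))].

(* The vertices of the graph are the corners, i.e., the endpoints of the edges. *)
Definition edges (c : chain) : seq (point * point) :=
  undup (flatten [seq sides s | s <- c]).

Definition deg (c : chain) (u : point) : nat :=
  count [pred e : point * point | (e.1 == u) || (e.2 == u)] (edges c).

(* All terms of the sum are rational, so the index takes its values in rat. *)
Definition AZI (c : chain) : rat :=
  \sum_(e <- edges c)
    (((deg c e.1)%:R * (deg c e.2)%:R)
       / ((deg c e.1)%:R + (deg c e.2)%:R - 2)) ^+ 3.

(* A run of consecutive squares is given by the pair (a, b) of the 0-based
   indices of its first and last squares. *)
Definition squares_of (c : chain) (r : nat * nat) : seq point :=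
  drop r.1 (take r.2.+1 c).

Definition aligned_run (c : chain) (r : nat * nat) : bool :=
  [&& (r.1 < r.2)%N, (r.2 < size c)%N
    & constant [seq s.1 | s <- squares_of c r]
      || constant [seq s.2 | s <- squares_of c r]].

Definition runs (c : chain) : seq (nat * nat) :=
  [seq r <- [seq (a, b) | a <- iota 0 (size c), b <- iota 0 (size c)]
     | aligned_run c r].

Definition segments (c : chain) : seq (nat * nat) :=
  [seq r <- runs c
     | all [pred r' | (r'.1 <= r.1)%N && (r.2 <= r'.2)%N ==> (r' == r)] (runs c)].

Definition seg_length (r : nat * nat) : nat := (r.2 - r.1).+1.

Definition external (c : chain) (r : nat * nat) : bool :=
  (r.1 == 0%N) || (r.2 == (size c).-1).

Definition internal (c : chain) (r : nat * nat) : bool := ~~ external c r.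

Definition AZ1 (m : nat) (c : chain) : Prop :=
  [/\ exists n, polyomino_chain n c,
      size (segments c) = m
    & forall r, r \in segments c -> seg_length r = 3].

Definition AZ2 (m : nat) (c : chain) : Prop :=
  [/\ exists n, polyomino_chain n c,
      size (segments c) = m
    & exists r, [/\ r \in segments c, internal c r, seg_length r = 2
      & forall r', r' \in segments c -> r' <> r -> seg_length r' = 3]].

Definition maximizes_AZI (n : nat) (c : chain) : Prop :=
  polyomino_chain n c /\
  forall c', polyomino_chain n c' -> AZI c' <= AZI c.

(* 4456/125 n - 26763/2000 - 2312/3375 I_{n even}; 26763 is split because a
   numeral of that size overflows the stack (numerals are unary here). *)
Definition maxAZI (n : nat) : rat :=
  4456 / 125 * n%:R - (26 * 1000 + 763) / 2000 - 2312 / 3375 * (~~ odd n)%:R.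

(* Main.v *)
(* Each step of a chain raises x - y by one, so a corner at level l only meets
   squares at levels l - 1, l and l + 1.  Hence prepending a square to a chain
   changes AZI by an amount that depends only on the first four squares, and AZI
   is an affine function of n minus a cost: 3829/4000 for a turn at the second or
   at the last but one square, 2312/3375 for two consecutive turns and
   11809/8000 for two consecutive non-turns.  Read off the segments, the cost is
   a sum of penalties that vanish exactly for the segments of length 3.  If n is
   even, not all segments have length 3, and the cheapest defect is a single
   internal segment of length 2. *)
Require Import Defs.
From mathcomp Require Import zify ring lra.

Set Implicit Arguments.
Unset Strict Implicit.
Unset Printing Implicit Defensive.

Import Order.TTheory GRing.Theory Num.Theory.

(** * Local effect of prepending a square, and invariance under translation *)

Section Locality.

Local Open Scope ring_scope.

Definition level (p : point) : int := p.1 - p.2.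

Definition edge_weight (i j : nat) : rat :=
  ((i%:R * j%:R) / (i%:R + j%:R - 2)) ^+ 3.

Definition touches (u : point) : pred (point * point) :=
  [pred e | (e.1 == u) || (e.2 == u)].

(** [undup] keeps the last occurrence of each side, so a side common to both parts is listed with
    [b]. *)
Lemma edges_cat (a b : chain) :
  edges (a ++ b) = [seq e <- edges a | e \notin edges b] ++ edges b.
Proof.
rewrite /edges map_cat flatten_cat undup_cat; congr (_ ++ _).
by apply: eq_filter => e; rewrite mem_undup.
Qed.

Lemma mem_edges (c : chain) (e : point * point) :
  reflect (exists2 s : point, s \in c & e \in sides s) (e \in edges c).
Proof. by rewrite mem_undup; apply: flatten_mapP. Qed.

Lemma deg_catl (a b : chain) (u : point) :
  (forall e : point * point, e \in edges b -> ~~ touches u e) -> deg (a ++ b) u = deg a u.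
Proof.
move=> Hb; rewrite /deg edges_cat count_cat -/(touches u) count_filter.
rewrite [X in (_ + X)%N](_ : _ = 0%N) ?addn0; last first.
  by apply/eqP; rewrite -leqn0 leqNgt -has_count; apply/hasPn.
(* The sides of [a] filtered out as shared belong to [b], so they avoid [u] anyway. *)
apply: eq_in_count => e _ /=.
by case Hu: (touches u e) => //=; apply: contraTN Hu => /Hb.
Qed.

Lemma deg_catr (a b : chain) (u : point) :
  (forall e : point * point, e \in edges a -> ~~ touches u e) -> deg (a ++ b) u = deg b u.
Proof.
move=> Ha; rewrite /deg edges_cat count_cat -/(touches u).
rewrite [X in (X + _)%N](_ : _ = 0%N) //.
apply/eqP; rewrite -leqn0 leqNgt -has_count; apply/hasPn => e.
by rewrite mem_filter => /andP[_ /Ha].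
Qed.

Lemma level_sides (s : point) (e : point * point) : e \in sides s ->
  [/\ level s - 1 <= level e.1 <= level s + 1,
      level s - 1 <= level e.2 <= level s + 1
    & level e.1 - 1 <= level e.2 <= level e.1 + 1].
Proof.
case: s => x y; rewrite !inE /level => /or4P[] /eqP-> /=;
by split; apply/andP; split; lia.
Qed.

(* The corners of a square at level [l] have levels at most l + 1. *)
Definition high (l : int) : pred (point * point) :=
  [pred e | (l + 2 <= level e.1) && (l + 2 <= level e.2)].

Definition AZI_on (P : pred (point * point)) (c : chain) : rat :=
  \sum_(e <- edges c | P e) edge_weight (deg c e.1) (deg c e.2).

Lemma AZI_split (P : pred (point * point)) (c : chain) :
  AZI c = AZI_on P c + AZI_on (predC P) c.
Proof. by rewrite /AZI (bigID P). Qed.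

Lemma touches_level (u : point) (e : point * point) :
  touches u e -> level u = level e.1 \/ level u = level e.2.
Proof. by case/orP => /eqP->; [left | right]. Qed.

(** The corners of [s] have level at most [level s + 1], so [s] neither owns a high edge nor changes
    the degree of an endpoint of one. *)
Lemma AZI_on_high (s : point) (b : chain) :
  AZI_on (high (level s)) (s :: b) = AZI_on (high (level s)) b.
Proof.
have Hs (e : point * point) : e \in edges [:: s] ->
    level e.1 <= level s + 1 /\ level e.2 <= level s + 1.
  case/mem_edges => s'; rewrite inE => /eqP->.
  by case/level_sides => /andP[_ H1] /andP[_ H2] _.
have Hdeg u : level s + 2 <= level u -> deg ([:: s] ++ b) u = deg b u.
  move=> Hu; apply: deg_catr => e /Hs[H1 H2].
  by apply/negP => /touches_level[] Hl; lia.
rewrite /AZI_on -[s :: b]/([:: s] ++ b) edges_cat big_cat /= big1_seq ?add0r.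
  by apply: eq_bigr => e /andP[H1 H2]; rewrite !Hdeg.
move=> e; rewrite mem_filter => /and3P[/andP[H1 H2] _ /Hs]; lia.
Qed.

(** An edge that is not high has one end at level at most [l + 1], hence both at most [l + 2],
    whereas the corners of the squares in [b] start at level [l + 3]. *)
Lemma AZI_on_low (l : int) (a b : chain) :
  (forall s : point, s \in b -> l + 4 <= level s) ->
  AZI_on (predC (high l)) (a ++ b) = AZI_on (predC (high l)) a.
Proof.
move=> Hb.
have Hs (e : point * point) :
    e \in edges b -> l + 3 <= level e.1 /\ l + 3 <= level e.2.
  case/mem_edges => s /Hb Hl /level_sides[] /andP[H1 _] /andP[H2 _] _.
  by split; lia.
have Hhigh (e : point * point) : e \in edges b -> high l e.
  by move=> /Hs[H1 H2]; apply/andP; split; lia.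
have Hlow (e : point * point) :
    e \in edges a -> ~~ high l e -> level e.1 <= l + 2 /\ level e.2 <= l + 2.
  move=> /mem_edges[s _ /level_sides[_ _ /andP[H1 H2]]].
  by rewrite /high /= => H; split; lia.
have Hdeg u : level u <= l + 2 -> deg (a ++ b) u = deg a u.
  move=> Hu; apply: deg_catl => e /Hs[H1 H2].
  by apply/negP => /touches_level[] Hl; lia.
rewrite /AZI_on edges_cat big_cat /= [X in _ + X]big1_seq ?addr0; last first.
  by move=> e /andP[/negP+ /Hhigh].
rewrite big_filter_cond [LHS]big_seq_cond [RHS]big_seq_cond.
apply: eq_big => [e|e /and3P[He _ Hl]].
  case: (e \in edges a) => //=; case He: (_ \in _) => //=.
  by rewrite (Hhigh _ He).
by have [H1 H2] := Hlow _ He Hl; rewrite !Hdeg.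
Qed.

(** Dropping [s] leaves the high part unchanged and dropping [b] leaves the low part unchanged, so
    the eight partial sums cancel in pairs. *)
Lemma AZI_local (s : point) (a b : chain) :
  (forall s' : point, s' \in b -> level s + 4 <= level s') ->
  AZI (s :: a ++ b) - AZI (a ++ b) = AZI (s :: a) - AZI a.
Proof.
move=> Hb; rewrite !(AZI_split (high (level s))) !AZI_on_high.
rewrite -[s :: a ++ b]/((s :: a) ++ b) !AZI_on_low //; ring.
Qed.

Definition translate (v p : point) : point := (p.1 + v.1, p.2 + v.2).

Lemma translate_inj (v : point) : injective (translate v).
Proof. by move=> [x y] [x' y'] [/addIr-> /addIr->]. Qed.

Definition translate_edge (v : point) (e : point * point) :=
  (translate v e.1, translate v e.2).

Lemma translate_edge_inj (v : point) : injective (translate_edge v).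
Proof.
move=> [p q] [p' q'] [H1 H2 H3 H4].
by congr (_, _); apply: (@translate_inj v); congr (_, _).
Qed.

Lemma edges_translate (v : point) (c : chain) :
  edges (map (translate v) c) = map (translate_edge v) (edges c).
Proof.
rewrite /edges -(undup_map_inj (@translate_edge_inj v)) map_flatten -!map_comp.
congr (undup (flatten _)); apply: eq_map => -[x y] /=.
by rewrite /translate_edge /translate /= !(addrAC _ 1).
Qed.

Lemma deg_translate (v : point) (c : chain) (u : point) :
  deg (map (translate v) c) (translate v u) = deg c u.
Proof.
rewrite /deg edges_translate count_map; apply: eq_count => e /=.
by rewrite !(inj_eq (@translate_inj v)).
Qed.

Lemma AZI_translate (v : point) (c : chain) : AZI (map (translate v) c) = AZI c.
Proof.
rewrite /AZI edges_translate big_map.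
by apply: eq_bigr => e _; rewrite !deg_translate.
Qed.

End Locality.

(** * [AZI] as an affine function of the size minus the cost of the turns *)

Section ClosedForm.

Local Open Scope ring_scope.

Definition step (d : bool) : point := if d then down else right.

(* The steps [true] and [false] go down and right. *)
Fixpoint walk (p : point) (ds : seq bool) : chain :=
  if ds is d :: ds' then p :: walk (translate (step d) p) ds' else [:: p].

Fixpoint steps (x : bool) (t : seq bool) : seq bool :=
  if t is a :: t' then (x (+) a) :: steps (x (+) a) t' else [::].

(* [t] lists the turns: its item of index i is [true] iff the chain changes
   direction at its square of index i + 1. *)
Definition staircase (t : seq bool) : chain :=
  walk (0, 0) (false :: steps false t).

Lemma squares_from_walk (s : point) (x : bool) (L : seq nat) :
  squares_from s (step x) L = walk s (steps x [seq l != 1%N | l <- L]).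
Proof.
elim: L s x => //= l L IH s x; congr (_ :: _); rewrite -IH.
by case: (l == 1%N); case: x.
Qed.

Lemma PC_staircase (L : seq nat) : PC L = staircase [seq l != 1%N | l <- L].
Proof. by rewrite /PC -[right]/(step false) squares_from_walk. Qed.

Lemma size_walk (p : point) (ds : seq bool) : size (walk p ds) = (size ds).+1.
Proof. by elim: ds p => //= d ds IH p; rewrite IH. Qed.

Lemma size_steps (x : bool) (t : seq bool) : size (steps x t) = size t.
Proof. by elim: t x => //= a t IH x; rewrite IH. Qed.

Lemma size_staircase (t : seq bool) : size (staircase t) = (size t).+2.
Proof. by rewrite size_walk /= size_steps. Qed.

Lemma polyomino_chainP (n : nat) (c : chain) :
  polyomino_chain n c <-> exists2 t, size t = n.-2 /\ (1 < n)%N & c = staircase t.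
Proof.
split=> [[L /andP[/eqP <- _] ->]|[t [Ht Hn] ->]].
  by exists [seq l != 1%N | l <- L]; rewrite ?size_map ?PC_staircase.
exists [seq if a then 2 else 1%N | a <- t].
  rewrite /link_vector size_map Ht; apply/andP; split; first lia.
  by apply/allP => _ /mapP[[] _ ->].
rewrite PC_staircase -map_comp /comp; congr staircase.
by elim: t {Ht} => //= -[] t <-.
Qed.

Lemma level_step (d : bool) (p : point) : level (translate (step d) p) = level p + 1.
Proof. by case: p d => x y []; rewrite /level /=; lia. Qed.

Lemma level_walk (ds : seq bool) (p s : point) : s \in walk p ds -> level p <= level s.
Proof.
elim: ds p => [|d ds IH] p /=; first by rewrite inE => /eqP->.
rewrite inE => /orP[/eqP->//|/IH]; rewrite level_step; lia.
Qed.

Lemma walk_translate (v p : point) (ds : seq bool) :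
  walk (translate v p) ds = map (translate v) (walk p ds).
Proof.
elim: ds p => //= d ds IH p; rewrite -IH; congr (_ :: walk _ _).
by rewrite /translate /= !(addrAC _ v.1) !(addrAC _ v.2).
Qed.

Lemma AZI_walk (p : point) (ds : seq bool) : AZI (walk p ds) = AZI (walk (0, 0) ds).
Proof.
rewrite -(AZI_translate p (walk (0, 0) ds)) -walk_translate.
by rewrite /translate !add0r; case: p.
Qed.

(** Lets the degree pairs of a concrete chain be evaluated over [nat], before any rational weight
    appears. *)
Lemma AZI_types (c : chain) (m : seq (nat * nat)) :
  [seq (deg c e.1, deg c e.2) | e <- edges c] = m ->
  AZI c = \sum_(q <- m) edge_weight q.1 q.2.
Proof. by move=> <-; rewrite big_map. Qed.

Lemma edge_weightC (i j : nat) : edge_weight i j = edge_weight j i.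
Proof. by rewrite /edge_weight [i%:R * _]mulrC [i%:R + _]addrC. Qed.

Lemma edge_weight2 (j : nat) : edge_weight 2 j.+1 = 8.
Proof.
have Hj0 : j.+1%:R != 0 :> rat by rewrite pnatr_eq0.
by rewrite /edge_weight [2 + _]addrC addrK mulfK //; ring.
Qed.

Lemma edge_weight33 : edge_weight 3 3 = 729 / 64.
Proof. by rewrite /edge_weight; field. Qed.

Lemma edge_weight34 : edge_weight 3 4 = 1728 / 125.
Proof. by rewrite /edge_weight; field. Qed.

Lemma edge_weight44 : edge_weight 4 4 = 512 / 27.
Proof. by rewrite /edge_weight; field. Qed.

(** Symmetry is used only on instances whose first degree is the larger one, so that rewriting
    cannot loop. *)
Definition edge_weightE :=
  (edge_weight2, fun j => edge_weightC j.+3 2, edge_weight33, edge_weight34,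
   edge_weightC 4 3, edge_weight44).

(** The middle one of three squares is both the second and the last but one, so a turn there pays
    3829/4000 twice. *)
Lemma AZI_walk2 (p : point) (x a : bool) :
  AZI (walk p [:: x; x (+) a]) =
    4456 / 125 * 3 - (26 * 1000 + 763) / 2000 - (3829 / 2000) * a%:R.
Proof.
rewrite AZI_walk.
by case: x; case: a; rewrite (AZI_types (erefl _)); set m := map _ _;
  vm_compute in m; rewrite /m !big_cons big_nil /= ?edge_weightE; lra.
Qed.

(* The constants are locked because unification would otherwise evaluate them
   as unary fractions. *)
Definition tt_cost : rat := locked (2312 / 3375).
Definition ff_cost : rat := locked (11809 / 8000).
Definition endturn_cost : rat := locked (3829 / 4000).

Lemma tt_costE : tt_cost = 2312 / 3375.
Proof. by rewrite /tt_cost -lock. Qed.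

Lemma ff_costE : ff_cost = 11809 / 8000.
Proof. by rewrite /ff_cost -lock. Qed.

Lemma endturn_costE : endturn_cost = 3829 / 4000.
Proof. by rewrite /endturn_cost -lock. Qed.

Definition pair_cost (a b : bool) : rat :=
  if a == b then if a then tt_cost else ff_cost else 0.

Definition end_cost (a : bool) : rat := if a then endturn_cost else 0.

Lemma AZI_walk3 (p : point) (x a b : bool) :
  AZI (walk p [:: x; x (+) a; x (+) a (+) b]) =
    4456 / 125 * 4 - (26 * 1000 + 763) / 2000
      - (end_cost a + pair_cost a b + end_cost b).
Proof.
rewrite AZI_walk /pair_cost /end_cost tt_costE ff_costE endturn_costE.
by case: x; case: a; case: b; rewrite (AZI_types (erefl _)); set m := map _ _;
  vm_compute in m; rewrite /m !big_cons big_nil /= ?edge_weightE; lra.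
Qed.

(** [a] is the flag of the square just before those of [t]; once [t] is empty, that square is the
    last but one of the chain. *)
Fixpoint tail_cost (a : bool) (t : seq bool) : rat :=
  if t is b :: t' then pair_cost a b + tail_cost b t' else end_cost a.

Definition turn_cost (t : seq bool) : rat :=
  if t is a :: t' then end_cost a + tail_cost a t' else 0.

(** By locality, the increment due to a new first square is that between the chains of three and
    four squares, both known explicitly. *)
Lemma AZI_walk_steps (p : point) (x a : bool) (t : seq bool) :
  AZI (walk p (x :: steps x (a :: t))) =
    4456 / 125 * (size t).+3%:R - (26 * 1000 + 763) / 2000 - turn_cost (a :: t).
Proof.
elim: t p x a => [|b t IH] p x a.
  by rewrite AZI_walk2 /= /end_cost endturn_costE; case: a => /=; lra.
set y := x (+) a; set z := y (+) b.
pose p1 := translate (step x) p; pose p2 := translate (step y) p1.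
pose p3 := translate (step z) p2.
(* Everything beyond [p3] lies at least four levels above [p], as [AZI_local] requires. *)
have [r Hr Er] : exists2 r, walk p3 (steps z t) = p3 :: r
    & forall s : point, s \in r -> level p + 4 <= level s.
  case: t {IH} => [|d t]; first by exists [::].
  eexists; first by [].
  by move=> s /level_walk; rewrite !level_step; lia.
have -> : walk p (x :: steps x [:: a, b & t]) = p :: [:: p1; p2; p3] ++ r.
  by rewrite /= -/y -/z -/p1 -/p2 -/p3 Hr.
have := AZI_local [:: p1; p2; p3] Er.
have -> : [:: p1; p2; p3] ++ r = walk p1 (y :: steps y (b :: t)).
  by rewrite /= -/z -/p2 -/p3 Hr.
have -> : [:: p, p1, p2 & [:: p3]] = walk p [:: x; x (+) a; x (+) a (+) b] by [].
have -> : [:: p1; p2; p3] = walk p1 [:: y; y (+) b] by [].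
rewrite IH AZI_walk3 AZI_walk2 /= => /(canRL (subrK _)) ->.
(* The increment contains [end_cost b] once net with a plus sign; it cancels the initial
   [end_cost b] of the shorter chain, whose second square is no longer second. *)
rewrite -[(size t).+4%:R]natr1 /end_cost endturn_costE.
by case: b {z p3 Hr Er} => /=; lra.
Qed.

Lemma AZI_staircase (t : seq bool) : (0 < size t)%N ->
  AZI (staircase t) =
    4456 / 125 * (size t).+2%:R - (26 * 1000 + 763) / 2000 - turn_cost t.
Proof. case: t => [|a t] Ht; [discriminate Ht | exact: AZI_walk_steps]. Qed.

End ClosedForm.

(** * Segments of a staircase, and their encoding by gaps *)

Section Segments.

Lemma take_walk (p : point) (ds : seq bool) (b : nat) :
  b <= size ds -> take b.+1 (walk p ds) = walk p (take b ds).
Proof.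
by elim: ds p b => [|d ds IH] p [|b] //= Hb; rewrite ?take0 // -IH.
Qed.

Lemma drop_walk (p : point) (ds : seq bool) (a : nat) :
  a <= size ds -> exists q, drop a (walk p ds) = walk q (drop a ds).
Proof.
elim: ds p a => [|d ds IH] p [|a] //= Ha; try by exists p.
exact: IH.
Qed.

Lemma all_fst_walk (x : int) (p : point) (ds : seq bool) :
  all (pred1 x) [seq s.1 | s <- walk p ds] = (p.1 == x) && all id ds.
Proof.
elim: ds p => [|d ds IH] p //=; rewrite IH; case: eqP => //= ->.
by case: d; rewrite /= ?addr0 ?eqxx //; case: eqP => //; lia.
Qed.

Lemma all_snd_walk (y : int) (p : point) (ds : seq bool) :
  all (pred1 y) [seq s.2 | s <- walk p ds] = (p.2 == y) && all negb ds.
Proof.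
elim: ds p => [|d ds IH] p //=; rewrite IH; case: eqP => //= ->.
by case: d; rewrite /= ?addr0 ?eqxx //; case: eqP => //; lia.
Qed.

Lemma constant_all_head (T : eqType) (x : T) (s : seq T) :
  constant (x :: s) = all (pred1 x) (x :: s).
Proof. by rewrite /= eqxx. Qed.

(** A step down fixes the first coordinate and lowers the second; a step right fixes the second and
    raises the first. *)
Lemma constant_walk (p : point) (ds : seq bool) :
  constant [seq s.1 | s <- walk p ds] || constant [seq s.2 | s <- walk p ds]
  = all id ds || all negb ds.
Proof.
have := all_fst_walk p.1 p ds; have := all_snd_walk p.2 p ds.
rewrite !eqxx /= => <- <-.
by case: ds => [|d ds]; rewrite !map_cons !constant_all_head.
Qed.

Lemma all_steps (y : bool) (u : seq bool) :
  all id (y :: steps y u) || all negb (y :: steps y u) = all negb u.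
Proof.
elim: u y => [|a u IH] y; first by case: y.
rewrite [RHS]/= -(IH (y (+) a)) /=.
by case: a; case: y => //=; rewrite ?andbF.
Qed.

Lemma take_steps (y : bool) (t : seq bool) (b : nat) :
  take b (steps y t) = steps y (take b t).
Proof. by elim: t y b => [|a t IH] y [|b] //=; rewrite IH. Qed.

Lemma drop_steps (y : bool) (t : seq bool) (a : nat) :
  a <= size t -> exists z, drop a (y :: steps y t) = z :: steps z (drop a t).
Proof.
elim: t y a => [|x t IH] y [|a] //= Ha; try by exists y.
exact: IH.
Qed.

(** A run is straight when no turn occurs at the squares [a + 1] to [b - 1], whose flags are the
    items [a] to [b - 2] of [t]. *)
Lemma aligned_staircase (t : seq bool) (a b : nat) :
  aligned_run (staircase t) (a, b)
  = [&& a < b, b <= (size t).+1 & all negb (drop a (take b.-1 t))].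
Proof.
rewrite /aligned_run size_staircase ltnS -[(a, b).1]/a -[(a, b).2]/b.
case: (ltnP a b) => // Hab; case: (leqP b) => // Hb; rewrite !andTb.
case: b Hab Hb => // b Hab Hb.
have Hs : size (take b t) = b by rewrite size_takel.
have [q Hq] : exists q, squares_of (staircase t) (a, b.+1)
    = walk q (drop a (false :: steps false (take b t))).
  rewrite /squares_of /staircase take_walk; last by rewrite /= size_steps.
  by rewrite [take _ _]/= take_steps; apply: drop_walk; rewrite /= size_steps Hs; lia.
rewrite Hq constant_walk.
have [z ->] := @drop_steps false (take b t) a ltac:(by rewrite Hs).
exact: all_steps.
Qed.

(* Indexed by squares, whence the initial [false]. *)
Definition turn_at (t : seq bool) (j : nat) : bool := nth false (false :: t) j.

Lemma alignedP (t : seq bool) (a b : nat) :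
  reflect [/\ a < b, b <= (size t).+1 & forall j, a < j -> j < b -> ~~ turn_at t j]
    (aligned_run (staircase t) (a, b)).
Proof.
rewrite aligned_staircase; apply: (iffP and3P) => -[Hab Hb H]; split=> //.
  move=> j Haj Hjb; case: j Haj Hjb => // j Haj Hjb.
  have Hj : j - a < size (drop a (take b.-1 t)).
    by rewrite size_drop size_takel; lia.
  have := all_nthP false H _ Hj.
  rewrite nth_drop nth_take; last lia.
  by rewrite /turn_at /= subnKC.
apply/(all_nthP false) => i; rewrite size_drop size_takel => [Hi|]; last lia.
have Hi' : a + i < b.-1 by lia.
rewrite nth_drop nth_take //.
by apply: (H (a + i).+1); lia.
Qed.

Lemma mem_runs (c : chain) (r : nat * nat) : (r \in runs c) = aligned_run c r.
Proof.
rewrite mem_filter; case H: (aligned_run c r) => //=.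
case: r H => a b /and3P[/= Hab Hb _].
by apply/allpairsP; exists (a, b); rewrite !mem_iota /=; split=> //; lia.
Qed.

(** A run whose end is neither a turn nor an end of the chain extends by one square there;
    conversely, a turn at its end would be interior to any extension. *)
Lemma mem_segments (t : seq bool) (a b : nat) :
  (a, b) \in segments (staircase t) <->
  [/\ a < b, b <= (size t).+1, forall j, a < j -> j < b -> ~~ turn_at t j,
      a = 0 \/ turn_at t a & b = (size t).+1 \/ turn_at t b].
Proof.
rewrite mem_filter mem_runs; split.
  case/andP => /allP Hmax Hal; have [Hab Hb H] := alignedP _ _ _ Hal; split=> //.
    case: a Hab Hal H Hmax => [|a] Hab Hal H Hmax; [by left | right].
    apply/negPn/negP => Ha.
    have Hr : (a, b) \in runs (staircase t).
      rewrite mem_runs; apply/alignedP; split; [lia | lia | move=> j Hj Hjb].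
      by case: (ltngtP j a.+1) => [||->]; [lia | move=> Hj'; apply: H | ].
    by have := Hmax _ Hr; rewrite /= leqnSn leqnn /= => /eqP[]; lia.
  case: (ltngtP b (size t).+1) => [Hlt||]; [right | lia | by left].
  apply/negPn/negP => Hb'.
  have Hr : (a, b.+1) \in runs (staircase t).
    rewrite mem_runs; apply/alignedP; split; [lia | lia | move=> j Hj Hjb].
    by case: (ltngtP j b) => [||->]; [move=> Hj'; apply: H | lia | ].
  by have := Hmax _ Hr; rewrite /= leqnSn leqnn /= => /eqP[]; lia.
case=> Hab Hb H Ha Hb'; apply/andP; split; last exact/alignedP.
apply/allP => -[a' b']; rewrite mem_runs => /alignedP[Hab' Hb2 H'] /=.
apply/implyP => /andP[H1 H2]; apply/eqP.
have -> : a' = a.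
  case: (ltngtP a' a) => //; last lia.
  move=> Hlt; case: Ha => [|Ha]; first lia.
  by have := H' a Hlt ltac:(lia); rewrite Ha.
have -> // : b' = b.
case: (ltngtP b b') => //; last lia.
move=> Hlt; case: Hb' => [|Hb']; first lia.
by have := H' b ltac:(lia) Hlt; rewrite Hb'.
Qed.

(* The segments from the one that starts at square [a] on, [t] listing the turns
   at the squares from [k] on. *)
Fixpoint segs (a k : nat) (t : seq bool) : seq (nat * nat) :=
  if t is x :: t' then
    if x then (a, k) :: segs k k.+1 t' else segs a k.+1 t'
  else [:: (a, k)].

(** [T] describes the turns of the whole chain and stays fixed in the induction, while [t] shrinks
    to its values from [k] on. *)
Lemma mem_segs (T : nat -> bool) (a k u v : nat) (t : seq bool) :
  a < k -> (forall j, a < j -> j < k -> ~~ T j) ->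
  (forall i, i < size t -> nth false t i = T (k + i)) ->
  (u, v) \in segs a k t <->
  [/\ u < v, k <= v <= k + size t, forall j, u < j -> j < v -> ~~ T j,
      u = a \/ k <= u /\ T u & v = k + size t \/ T v].
Proof.
elim: t a k => [|x t IH] a k Hak Hno HT.
  rewrite /= addn0 inE; split=> [/eqP[-> ->]|[H1 H2 H3 H4 H5]].
    by split=> //; [lia | left | left].
  by apply/eqP; congr (_, _); lia.
have Hx : x = T k by have := HT 0 isT; rewrite addn0.
have HT' i : i < size t -> nth false t i = T (k.+1 + i).
  by move=> Hi; rewrite addSnnS -(HT i.+1).
case: x Hx HT => Hx _.
  have {}IH := IH k k.+1 (ltnSn k) ltac:(by move=> j; lia) HT'.
  rewrite [segs _ _ _]/= inE [size _]/=; split.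
    case/orP => [/eqP[-> ->]|/IH[H1 H2 H3 H4 H5]].
      by split=> //; [lia | left | right].
    split=> //; [lia | | by case: H5; [left; lia | right]].
    right; case: H4 => [->|[H4 H4']]; first by rewrite -Hx.
    by split; first exact: ltnW.
  case=> H1 H2 H3 H4 H5; apply/orP; case: H4 => [Hu|[Hku Tu]].
    left; apply/eqP; congr (_, _) => //.
    apply/eqP; rewrite eqn_leq; case/andP: H2 => -> _; rewrite andbT leqNgt.
    by apply/negP => Hkv; have := H3 k; rewrite -Hx Hu => /(_ Hak Hkv).
  right; apply/IH; split=> //; [lia | | by case: H5; [left; lia | right]].
  by case: (ltngtP k u) Hku => // Hlt _; [right | left].
have {}IH := IH a k.+1 (leqW Hak) _ HT'.
have Hno' j : a < j -> j < k.+1 -> ~~ T j.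
  move=> Haj; rewrite ltnS leq_eqVlt.
  by case/orP => [/eqP->|/(Hno _ Haj)//]; rewrite -Hx.
rewrite [segs _ _ _]/= [size _]/=; split.
  case/(IH Hno') => H1 H2 H3 H4 H5; split=> //; first lia.
    by case: H4 => [|[H4 H4']]; [left | right; split=> //; exact: ltnW].
  by case: H5; [left; lia | right].
case=> H1 H2 H3 H4 H5; apply/(IH Hno'); split=> //.
- have : v <> k by move=> Hv; case: H5; rewrite Hv -?Hx //; lia.
  by lia.
- case: H4 => [|[H4 H4']]; [by left | right; split=> //].
  by case: (ltngtP k u) H4 => // Hku _; move: H4'; rewrite -Hku -Hx.
- by case: H5; [left; lia | right].
Qed.

Lemma segs_uniq (a k : nat) (t : seq bool) : a < k -> uniq (segs a k t).
Proof.
have Hfst u v t' : forall a' k', a' < k' -> (u, v) \in segs a' k' t' -> a' <= u.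
  elim: t' => [|[] t' IH] a' k' Hak /=.
  - by rewrite inE => /eqP[->].
  - by rewrite inE => /orP[/eqP[->]//|/IH H]; apply: leq_trans (ltnW Hak) (H _).
  - by move=> /IH; apply; exact: leqW.
elim: t a k => [|[] t IH] a k Hak //=.
- rewrite IH // andbT; apply/negP => /Hfst; move=> /(_ (ltnSn k)); lia.
- by apply: IH; exact: leqW.
Qed.

(** Passes from maximal runs to the recursive list: both are duplicate free and have the same
    members. *)
Lemma perm_segments (t : seq bool) : perm_eq (segments (staircase t)) (segs 0 1 t).
Proof.
apply: uniq_perm.
- rewrite /segments /runs !filter_uniq //; apply: allpairs_uniq; try exact: iota_uniq.
  by move=> [? ?] [? ?] _ _.
- exact: segs_uniq.
move=> [u v].
have H := @mem_segs (turn_at t) 0 1 u v t isT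
  ltac:(by move=> j; lia) ltac:(by []).
apply/idP/idP => [/mem_segments[H1 H2 H3 H4 H5]|/H[H1 H2 H3 H4 H5]].
  apply/H; split=> //; [lia| ].
  case: (posnP u) => Hu; [by left | right; split=> //].
  by case: H4 Hu => // ->.
apply/mem_segments; split=> //; [lia | ].
by case: H4 => [|[]]; [left | right].
Qed.

(* The differences b - a of the segments (a, b), i.e., their lengths minus one;
   [k] is the part already travelled of the current segment. *)
Fixpoint gaps (k : nat) (t : seq bool) : seq nat :=
  if t is x :: t' then if x then k :: gaps 1 t' else gaps k.+1 t' else [:: k].

Lemma gaps_segs (a k : nat) (t : seq bool) :
  a <= k -> [seq r.2 - r.1 | r <- segs a k t] = gaps (k - a) t.
Proof.
elim: t a k => [|[] t IH] a k Hak //=.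
- by rewrite IH // subSn // subnn.
- by rewrite IH ?subSn //; exact: leqW.
Qed.

Lemma sumn_gaps (k : nat) (t : seq bool) : sumn (gaps k t) = k + size t.
Proof. by elim: t k => [|[] t IH] k //=; rewrite IH; lia. Qed.

Lemma gaps_gt0 (k : nat) (t : seq bool) : 0 < k -> all (ltn 0) (gaps k t).
Proof. by elim: t k => [|[] t IH] k Hk //=; rewrite ?Hk ?IH. Qed.

(** Inverse of [gaps 1] on nonempty lists of positive numbers: a gap [g] has [g - 1] interior
    squares, and a turn separates neighbouring gaps. *)
Fixpoint turns (gs : seq nat) : seq bool :=
  if gs is g :: gs' then
    nseq g.-1 false ++ (if nilp gs' then [::] else true :: turns gs')
  else [::].

Lemma gaps_nilF (k : nat) (t : seq bool) : nilp (gaps k t) = false.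
Proof. by elim: t k => [|[] t IH] k //=. Qed.

(** The leading non-turns restore the part of the first segment already travelled. *)
Lemma gapsK (k : nat) (t : seq bool) :
  0 < k -> turns (gaps k t) = nseq k.-1 false ++ t.
Proof.
elim: t k => [|[] t IH] k Hk //=.
- by rewrite gaps_nilF IH.
- rewrite IH //=; case: k Hk => //= k _; elim: k => //= k <-; done.
Qed.

Lemma gaps_nseq (k m : nat) (t : seq bool) :
  gaps k (nseq m false ++ t) = gaps (k + m) t.
Proof. by elim: m k => [|m IH] k /=; rewrite ?addn0 // IH addSnnS. Qed.

Lemma turnsK (gs : seq nat) :
  all (ltn 0) gs -> ~~ nilp gs -> gaps 1 (turns gs) = gs.
Proof.
elim: gs => //= g gs IH /andP[Hg Hgs] _; rewrite gaps_nseq add1n prednK //.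
by case: ifPn => [/nilP->|Hn] //=; rewrite IH.
Qed.

Lemma size_segments (t : seq bool) :
  size (segments (staircase t)) = size (gaps 1 t).
Proof. by rewrite (perm_size (perm_segments t)) -[1]/(1 - 0) -gaps_segs // size_map. Qed.

Lemma turns_inj (t t' : seq bool) : gaps 1 t = gaps 1 t' -> t = t'.
Proof. by move=> H; rewrite -[t](@gapsK 1) // H gapsK. Qed.

End Segments.

(** * The cost as a sum of penalties over segments, and its smallest values *)

Section Cost.

Local Open Scope ring_scope.

Lemma tt_cost_gt0 : 0 < tt_cost.
Proof. rewrite tt_costE; lra. Qed.

Lemma tt_lt_endturn_cost : tt_cost < endturn_cost.
Proof. rewrite tt_costE endturn_costE; lra. Qed.

Lemma tt_lt_ff_cost : tt_cost < ff_cost.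
Proof. rewrite tt_costE ff_costE; lra. Qed.

(** The [g - 1] interior squares form [g - 2] adjacent pairs of non-turns. A gap 1 joins two
    adjacent turns, or a turn and an end of the chain. *)
Definition gap_cost (ext : bool) (g : nat) : rat :=
  if (g <= 1)%N then (if ext then endturn_cost else tt_cost)
  else ff_cost * (g - 2)%:R.

Fixpoint gaps_cost (first : bool) (gs : seq nat) : rat :=
  if gs is g :: gs' then gap_cost (first || nilp gs') g + gaps_cost false gs' else 0.

(** Mutual induction on whether the last square read is a non-turn, with [k] pairs of non-turns
    already met in its segment, or a turn. *)
Lemma gaps_cost_false (b : bool) (k : nat) (t : seq bool) :
  gaps_cost b (gaps k.+2 t) = ff_cost * k%:R + tail_cost false t
with gaps_cost_true (t : seq bool) :
  gaps_cost false (gaps 1 t) = tail_cost true t.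
Proof.
  case: t => [|[] t].
  - rewrite /= /gap_cost /= subn2 /end_cost; ring.
  - rewrite /= gaps_cost_true /gap_cost /= subn2 /pair_cost /=; ring.
  - rewrite /= gaps_cost_false /pair_cost /= -natr1; ring.
case: t => [|[] t].
- rewrite /= /gap_cost /end_cost /=; ring.
- by rewrite /= gaps_cost_true gaps_nilF.
- rewrite /= gaps_cost_false /pair_cost /=; ring.
Qed.

Lemma turn_cost_gaps (t : seq bool) : (0 < size t)%N ->
  turn_cost t = gaps_cost true (gaps 1 t).
Proof.
case: t => [|[] t] Ht; first discriminate Ht.
- by rewrite /= gaps_cost_true.
- rewrite /= gaps_cost_false /end_cost; ring.
Qed.

(** Ranks the defects: [tt_cost] is below both [endturn_cost] and [ff_cost], so an internal gap 1 is
    the cheapest. *)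
Lemma gap_costP (ext : bool) (g : nat) : (0 < g)%N ->
  [\/ g = 2%N /\ gap_cost ext g = 0,
      [/\ g = 1%N, ext = false & gap_cost ext g = tt_cost]
    | [/\ g <> 2%N, ext || (g != 1%N) & tt_cost < gap_cost ext g]].
Proof.
case: g => [//|[|[|g]]] _; rewrite /gap_cost /=.
- case: ext; [apply: Or33 | by apply: Or32].
  by split=> //; exact: tt_lt_endturn_cost.
- by apply: Or31; rewrite subnn mulr0.
- apply: Or33; split=> //; first by rewrite orbT.
  rewrite !subSS subn0 -natr1; have := ler0n rat g.
  have := tt_cost_gt0; have := tt_lt_ff_cost; nra.
Qed.

Lemma gaps_cost_ge0 (b : bool) (gs : seq nat) :
  all (ltn 0) gs -> 0 <= gaps_cost b gs.
Proof.
elim: gs b => [|g gs IH] b; first by [].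
case/andP => /(gap_costP (b || nilp gs)) Hg /(IH false) /=.
by have := tt_cost_gt0; case: Hg => [[_ ->]|[_ _ ->]|[_ _]]; lra.
Qed.

Lemma gaps_cost_nseq2 (b : bool) (m : nat) : gaps_cost b (nseq m 2%N) = 0.
Proof. by elim: m b => //= m IH b; rewrite IH /gap_cost /= subnn mulr0 addr0. Qed.

Lemma gaps_cost_eq0 (b : bool) (gs : seq nat) : all (ltn 0) gs ->
  gaps_cost b gs = 0 -> gs = nseq (size gs) 2%N.
Proof.
elim: gs b => [|g gs IH] b; first by [].
case/andP => /(gap_costP (b || nilp gs)) Hg Hgs /=.
have := tt_cost_gt0; have := gaps_cost_ge0 false Hgs.
case: Hg => [[-> ->] _ _|[_ _ ->]|[_ _]]; try by move=> *; exfalso; lra.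
by rewrite add0r => /(IH _ Hgs) {1}->.
Qed.

(** The condition on [i] and the successor [j.+1] keep the gap 1 off both ends, where it would cost
    [endturn_cost]. *)
Lemma gaps_cost_one1 (b : bool) (i j : nat) :
  ~~ b || (0 < i)%N -> gaps_cost b (nseq i 2%N ++ 1%N :: nseq j.+1 2%N) = tt_cost.
Proof.
elim: i b => [|i IH] b /= Hi.
  move: Hi; rewrite orbF => /negPf->.
  by rewrite gaps_cost_nseq2 /gap_cost /= subnn mulr0 !addr0.
by rewrite IH // /gap_cost /= subnn mulr0 add0r.
Qed.

Lemma gaps_cost_gt0 (b : bool) (gs : seq nat) : all (ltn 0) gs ->
  gs <> nseq (size gs) 2%N -> tt_cost <= gaps_cost b gs.
Proof.
elim: gs b => [|g gs IH] b; first by [].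
case/andP => /(gap_costP (b || nilp gs)) Hg Hgs /=.
have := tt_cost_gt0; have := gaps_cost_ge0 false Hgs.
case: Hg => [[-> ->] _ _|[_ _ ->]|[_ _]]; try lra.
move=> Hn; rewrite add0r; apply: IH => // H.
by apply: Hn; congr (_ :: _); exact: H.
Qed.

(** The first defect already costs at least [tt_cost], so equality forces it to be of the cheapest
    kind and the only one. *)
Lemma gaps_cost_min (b : bool) (gs : seq nat) : all (ltn 0) gs ->
  gaps_cost b gs = tt_cost ->
  exists i j : nat, ~~ b || (0 < i)%N /\ gs = nseq i 2%N ++ 1%N :: nseq j.+1 2%N.
Proof.
elim: gs b => [|g gs IH] b; first by have := tt_cost_gt0; move=> H _ /= Heq; exfalso; lra.
case/andP => /(gap_costP (b || nilp gs)) Hg Hgs /=.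
have := tt_cost_gt0; have := gaps_cost_ge0 false Hgs.
case: Hg => [[-> ->] _ _|[-> Hb ->] H0 _ H|[_ _]]; last by move=> *; exfalso; lra.
  rewrite add0r => /(IH _ Hgs)[i [j [_ ->]]].
  by exists i.+1, j; rewrite orbT.
have /(gaps_cost_eq0 Hgs) Hgs2 : gaps_cost false gs = 0 by lra.
(* The defect is internal, so at least one gap follows it. *)
move: Hb Hgs2; case: b {H} => //=; case: gs {H0 Hgs IH} => //= g' gs _ ->.
by exists 0%N, (size gs).
Qed.

End Cost.

(** * The families [AZ1] and [AZ2] in terms of gaps *)

Section Families.

Definition seg_gap (r : nat * nat) : nat := r.2 - r.1.

(** Consecutive segments share a square, so the gaps before and after [r] add up to its distances
    from the two ends. *)
Lemma segs_split (a k : nat) (t : seq bool) (s1 s2 : seq (nat * nat)) (r : nat * nat) :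
  a <= k -> segs a k t = s1 ++ r :: s2 ->
  r.1 = a + sumn (map seg_gap s1) /\ r.2 + sumn (map seg_gap s2) = k + size t.
Proof.
elim: t a k s1 => [|[] t IH] a k s1 Hak /=.
- case: s1 => [|x [|y s1]] //= -[<- <-] /=; lia.
- case: s1 => [|x s1] /= [<- H].
    split; first by rewrite addn0.
    by rewrite -H (@gaps_segs k k.+1 t (leqnSn k)) subSnn sumn_gaps /=; lia.
  by have [-> ->] := IH _ _ _ (leqnSn k) H; rewrite /seg_gap /=; lia.
- by move/(IH _ _ _ (leqW Hak)) => [-> ->]; lia.
Qed.

Lemma gaps_staircase (t : seq bool) : map seg_gap (segs 0 1 t) = gaps 1 t.
Proof. exact: (@gaps_segs 0 1). Qed.

Lemma all_eq2_nseq (s : seq (nat * nat)) :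
  (forall r, r \in s -> seg_length r = 3) -> map seg_gap s = nseq (size s) 2.
Proof.
elim: s => //= r s IH H; congr (_ :: _).
  by have := H r (mem_head _ _); rewrite /seg_length /seg_gap; lia.
by apply: IH => r' Hr'; apply: H; rewrite inE Hr' orbT.
Qed.

Lemma nseq2_seg_length (s : seq (nat * nat)) (m : nat) (r : nat * nat) :
  map seg_gap s = nseq m 2 -> r \in s -> seg_length r = 3.
Proof.
move=> Hs /(map_f seg_gap); rewrite Hs mem_nseq => /andP[_ /eqP].
by rewrite /seg_length /seg_gap; lia.
Qed.

Lemma staircase_polyomino (t : seq bool) : exists n, polyomino_chain n (staircase t).
Proof. by exists (size t).+2; apply/polyomino_chainP; exists t. Qed.

Lemma AZ1_staircase (m : nat) (t : seq bool) :
  AZ1 m (staircase t) <-> gaps 1 t = nseq m 2.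
Proof.
have Hm := perm_mem (perm_segments t).
split=> [[_ Hs H]|Hg].
  have := @all_eq2_nseq (segs 0 1 t) (fun r => _).
  rewrite gaps_staircase => ->; last by move=> r; rewrite -Hm; apply: H.
  by rewrite -(perm_size (perm_segments t)) Hs.
split; [exact: staircase_polyomino | by rewrite size_segments Hg size_nseq |].
by move=> r; rewrite Hm; apply: (@nseq2_seg_length _ m); rewrite gaps_staircase.
Qed.

Lemma sumn_seg_gap_gt0 (s : seq (nat * nat)) :
  all (ltn 0) (map seg_gap s) -> (sumn (map seg_gap s) == 0) = nilp s.
Proof. by case: s => //= r s /andP[]; case: (seg_gap r). Qed.

(** Gaps are positive, so [r] reaches an end of the chain only if no segment lies on that side. *)
Lemma internal_staircase (t : seq bool) (s1 s2 : seq (nat * nat)) (r : nat * nat) :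
  segs 0 1 t = s1 ++ r :: s2 ->
  internal (staircase t) r = ~~ nilp s1 && ~~ nilp s2.
Proof.
move=> Ht; have [H1 H2] := segs_split (leq0n 1) Ht.
have := gaps_gt0 t (ltnSn 0); rewrite -gaps_staircase Ht map_cat all_cat /=.
case/and3P => /sumn_seg_gap_gt0 <- _ /sumn_seg_gap_gt0 <-.
rewrite /internal /external size_staircase negb_or H1 add0n; congr (_ && ~~ _).
by apply/eqP/eqP; move: H2; rewrite /=; lia.
Qed.

Lemma mem_split (T : eqType) (x : T) (s : seq T) :
  x \in s -> exists s1 s2, s = s1 ++ x :: s2.
Proof. by case/splitPr => s1 s2; exists s1, s2. Qed.

Lemma map_split (T1 T2 : Type) (f : T1 -> T2) (s : seq T1) (g1 g2 : seq T2) (y : T2) :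
  map f s = g1 ++ y :: g2 ->
  exists s1 x s2, [/\ s = s1 ++ x :: s2, map f s1 = g1, f x = y & map f s2 = g2].
Proof.
elim: g1 s => [|z g1 IH] [|x s] //= [Hx Hs]; first by exists [::], x, s.
by have [s1 [x' [s2 [-> <- <- <-]]]] := IH _ Hs; exists (x :: s1), x', s2; rewrite -Hx.
Qed.

Lemma AZ2_staircase (m : nat) (t : seq bool) :
  AZ2 m (staircase t) <->
  exists i j, m = i + j + 3 /\ gaps 1 t = nseq i.+1 2 ++ 1 :: nseq j.+1 2.
Proof.
have Hm := perm_mem (perm_segments t).
have Hu := @segs_uniq 0 1 t isT.
split=> [[_ Hs [r [Hr Hi Hl H]]]|[i [j [-> Hg]]]].
  move: Hr; rewrite Hm => /mem_split[s1 [s2 E]].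
  move: Hi; rewrite (internal_staircase E) => /andP[Hn1 Hn2].
  (* Without duplicates, the segments in [s1] and [s2] all differ from [r], hence have length 3. *)
  move: Hu; rewrite E cat_uniq /= => /and4P[_ /norP[Hr1 _] Hr2 _].
  have H1 : map seg_gap s1 = nseq (size s1) 2.
    apply: all_eq2_nseq => r' Hr'; apply: H => [|Hrr].
      by rewrite Hm E mem_cat Hr'.
    by rewrite -Hrr Hr' in Hr1.
  have H2 : map seg_gap s2 = nseq (size s2) 2.
    apply: all_eq2_nseq => r' Hr'; apply: H => [|Hrr].
      by rewrite Hm E mem_cat inE Hr' !orbT.
    by rewrite -Hrr Hr' in Hr2.
  move: Hs; rewrite (perm_size (perm_segments t)) -gaps_staircase E.
  rewrite size_cat map_cat /= H1 H2.
  have -> : seg_gap r = 1 by move: Hl; rewrite /seg_length /seg_gap; lia.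
  case: s1 Hn1 {E Hr1 H1} => // x1 s1 _; case: s2 Hn2 {Hr2 H2} => // x2 s2 _ /= <-.
  by exists (size s1), (size s2); split; first by rewrite !addnS addn0 addSn.
split; [exact: staircase_polyomino | |].
  by rewrite size_segments Hg size_cat /= !size_nseq; lia.
have [s1 [r [s2 [E H1 Hr H2]]]] := map_split (etrans (gaps_staircase t) Hg).
exists r; split.
- by rewrite Hm E mem_cat mem_head orbT.
- rewrite (internal_staircase E).
  by case: s1 H1 {E} => //; case: s2 H2.
- by rewrite /seg_length -/(seg_gap r) Hr.
move=> r'; rewrite Hm E mem_cat inE => /or3P[Hr' _|/eqP-> //|Hr' _].
  exact: nseq2_seg_length H1 Hr'.
exact: nseq2_seg_length H2 Hr'.
Qed.

End Families.

(** * Maximizers as words of least cost, for each parity of [n] *)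

Section Maximum.

Local Open Scope ring_scope.

Definition AZI_bound (n : nat) : rat :=
  4456 / 125 * n%:R - (26 * 1000 + 763) / 2000.

Lemma maxAZI_bound (n : nat) : maxAZI n = AZI_bound n - tt_cost * (~~ odd n)%:R.
Proof. rewrite tt_costE; reflexivity. Qed.

Lemma AZI_gaps (n : nat) (t : seq bool) : (2 < n)%N -> size t = n.-2 ->
  AZI (staircase t) = AZI_bound n - gaps_cost true (gaps 1 t).
Proof.
move=> Hn Ht; have Ht0 : (0 < size t)%N by rewrite Ht; lia.
rewrite -(turn_cost_gaps Ht0) (AZI_staircase Ht0) Ht.
have -> : n.-2.+2 = n by lia.
reflexivity.
Qed.

Lemma sumn_nseq2 (m : nat) : sumn (nseq m 2%N) = (2 * m)%N.
Proof. by rewrite sumn_nseq mulnC. Qed.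

Lemma size_turns (gs : seq nat) : all (ltn 0) gs -> ~~ nilp gs ->
  (size (turns gs)).+1 = sumn gs.
Proof. by move=> H1 H2; rewrite -[in RHS](turnsK H1 H2) sumn_gaps. Qed.

Lemma nseq2_gt0 (m : nat) : all (ltn 0) (nseq m 2%N).
Proof. by apply/allP => x; rewrite mem_nseq => /andP[_ /eqP->]. Qed.

(** For fixed [n], [AZI] and the cost add up to [AZI_bound n], so maximizing the one is minimizing
    the other. *)
Lemma maximizesP (n : nat) (t0 : seq bool) (c : chain) :
  (2 < n)%N -> size t0 = n.-2 ->
  (forall t, size t = n.-2 ->
     gaps_cost true (gaps 1 t0) <= gaps_cost true (gaps 1 t)) ->
  maximizes_AZI n c <->
  exists t, [/\ c = staircase t, size t = n.-2
    & gaps_cost true (gaps 1 t) = gaps_cost true (gaps 1 t0)].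
Proof.
move=> Hn H0 Hmin; have Hn1 : (1 < n)%N by lia.
split=> [[/polyomino_chainP[t [Ht _] ->] Hmax]|[t [-> Ht Heq]]].
  exists t; split=> //; apply/eqP; rewrite eq_le Hmin // andbT.
  have /Hmax : polyomino_chain n (staircase t0) by apply/polyomino_chainP; exists t0.
  by rewrite (AZI_gaps Hn Ht) (AZI_gaps Hn H0) lerD2l lerN2.
split; first by apply/polyomino_chainP; exists t.
move=> c' /polyomino_chainP[t' [Ht' _] ->].
by rewrite (AZI_gaps Hn Ht) (AZI_gaps Hn Ht') lerD2l lerN2 Heq Hmin.
Qed.

Lemma odd_optimum (n m : nat) : n = (2 * m)%N.+1 -> (0 < m)%N ->
  let t0 := turns (nseq m 2%N) in
  [/\ gaps 1 t0 = nseq m 2%N, size t0 = n.-2,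
      forall t, size t = n.-2 ->
        gaps_cost true (gaps 1 t0) <= gaps_cost true (gaps 1 t)
    & forall t, size t = n.-2 ->
        gaps_cost true (gaps 1 t) = gaps_cost true (gaps 1 t0) -> t = t0].
Proof.
move=> Hn Hm t0; have Hnil : ~~ nilp (nseq m 2%N) by case: m Hm {Hn t0}.
have E0 : gaps 1 t0 = nseq m 2%N by exact: turnsK (nseq2_gt0 m) Hnil.
split=> //.
- by have := size_turns (nseq2_gt0 m) Hnil; rewrite -/t0 sumn_nseq2 Hn; lia.
- by move=> t _; rewrite E0 gaps_cost_nseq2 gaps_cost_ge0 // gaps_gt0.
move=> t Ht; rewrite E0 gaps_cost_nseq2 => /(gaps_cost_eq0 (gaps_gt0 t (ltnSn 0))) Hg.
apply: turns_inj; rewrite E0 Hg; congr (nseq _ _).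
(* The gaps sum to [n - 1 = 2 * m], which fixes their number. *)
have := sumn_gaps 1 t; rewrite Hg sumn_nseq2 size_nseq Ht; lia.
Qed.

Lemma even_optimum (n m : nat) : n = (2 * m)%N -> (2 < m)%N ->
  let t0 := turns [:: 2%N, 1%N & nseq m.-2 2] in
  [/\ gaps_cost true (gaps 1 t0) = tt_cost, size t0 = n.-2
    & forall t, size t = n.-2 ->
        gaps_cost true (gaps 1 t0) <= gaps_cost true (gaps 1 t)].
Proof.
move=> Hn Hm t0; have Hpos : all (ltn 0) [:: 2%N, 1%N & nseq m.-2 2] by rewrite /= nseq2_gt0.
have E0 : gaps_cost true (gaps 1 t0) = tt_cost.
  (* As [m.-2] is positive, a gap follows the gap 1, which is thus internal. *)
  rewrite turnsK //; have -> : m.-2 = m.-2.-1.+1 by lia.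
  exact: (@gaps_cost_one1 true 1).
split=> //.
  by have := size_turns Hpos isT; rewrite -/t0 /= sumn_nseq2 Hn; lia.
move=> t Ht; rewrite E0; apply: gaps_cost_gt0; first exact: gaps_gt0.
(* The gaps sum to the odd number [n - 1], so they cannot all be 2. *)
move=> Hg; have := sumn_gaps 1 t; rewrite Hg sumn_nseq2 Ht; lia.
Qed.

End Maximum.

Theorem theorem3 (n : nat) (hn : 5 <= n) :
  [/\ odd n ->
        exists c : chain, unique (AZ1 ((n - 1) %/ 2)) c
          /\ forall c' : chain, maximizes_AZI n c' <-> c' = c,
      ~~ odd n ->
        forall c : chain, maximizes_AZI n c <-> AZ2 (n %/ 2) c
    & exists2 c : chain, maximizes_AZI n c & AZI c = maxAZI n].
Proof.
have Hn2 : 2 < n by lia.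
split=> [Hodd|Heven|].
- set m := _ %/ 2; have Hm : n = (2 * m).+1 by rewrite /m; lia.
  have [E0 H0 Hmin Huniq] := odd_optimum Hm ltac:(lia).
  set t0 := turns _ in E0 H0 Hmin Huniq.
  exists (staircase t0); split; first split.
  + exact/AZ1_staircase.
  + move=> c' Hc'; have [[n' /polyomino_chainP[t _ Hc]] _ _] := Hc'.
    move: Hc'; rewrite Hc => /AZ1_staircase Hg.
    by rewrite (@turns_inj t t0) // E0.
  + move=> c'; split=> [/(maximizesP _ Hn2 H0 Hmin)[t [-> Ht Heq]]|->].
      by rewrite (Huniq t).
    by apply/(maximizesP _ Hn2 H0 Hmin); exists t0.
- set m := _ %/ 2 => c; have Hm : n = 2 * m by rewrite /m; lia.
  have [E0 H0 Hmin] := even_optimum Hm ltac:(lia).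
  set t0 := turns _ in E0 H0 Hmin.
  split=> [/(maximizesP _ Hn2 H0 Hmin)[t [-> Ht]]|Hc].
    (* The case of no gap before the gap 1 is excluded, since it would be external. *)
    rewrite E0 => /(gaps_cost_min (gaps_gt0 t (ltnSn 0)))[[|i] [j [//= _ Hg]]].
    apply/AZ2_staircase; exists i, j; split=> //.
    by have := sumn_gaps 1 t; rewrite Hg /= sumn_cat /= !sumn_nseq2 Ht; lia.
  have [[n' /polyomino_chainP[t _ Et]] _ _] := Hc.
  move: Hc; rewrite Et => /AZ2_staircase[i [j [Hij Hg]]].
  apply/(maximizesP _ Hn2 H0 Hmin); exists t; split=> //.
    (* [AZ2] prescribes only the number of segments; the gap sum recovers the number of squares. *)
    by have := sumn_gaps 1 t; rewrite Hg /= sumn_cat /= !sumn_nseq2; lia.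
  by rewrite E0 Hg gaps_cost_one1.
- case Hodd: (odd n).
    have Hm : n = (2 * ((n - 1) %/ 2)).+1 by lia.
    have [E0 H0 Hmin _] := odd_optimum Hm ltac:(lia).
    exists (staircase (turns (nseq ((n - 1) %/ 2) 2))).
      by apply/(maximizesP _ Hn2 H0 Hmin); eexists; split.
    by rewrite (AZI_gaps Hn2 H0) E0 gaps_cost_nseq2 maxAZI_bound Hodd mulr0; move: (AZI_bound n).
  have Hm : n = 2 * (n %/ 2) by lia.
  have [E0 H0 Hmin] := even_optimum Hm ltac:(lia).
  exists (staircase (turns [:: 2, 1 & nseq (n %/ 2).-2 2])).
    by apply/(maximizesP _ Hn2 H0 Hmin); eexists; split.
  by rewrite (AZI_gaps Hn2 H0) E0 maxAZI_bound Hodd mulr1; move: (AZI_bound n).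
Qed.
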